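(* Let $\eta\in(0,1)$ and $d=\Omega(\log n)$. For a stream of $n$ triples $(q_i,k_i,v_i)\in(\mathbb{R}^d)^3$ let $Z_n:=\operatorname{Attn}(q_n,K_n,V_n)$. Any streaming algorithm that can, with probability at least $9/10$, produce an output $\mathcal{O}\in\mathbb{R}^d$ that is a $(1\pm\eta)$-approximation of $Z_n$ must use at least $\Omega(nd)$ bits of memory.
   Context: Setting (attention-based token generation / KV cache compression): the input is a stream of $n$ triples $(q_i,k_i,v_i)\in(\mathbb{R}^d)^3$ arriving one at a time. A (possibly randomized) one-pass streaming algorithm processes the triples in order, keeping a memory state whose size in bits is its space usage; its guarantee must hold for every input stream, the probability being over its own randomness. $K_n$ and $V_n$ are the $n\times d$ matrices whose rows are $k_1^T,\dots,k_n^T$ and $v_1^T,\dots,v_n^T$ respectively. The attention function is $\operatorname{Attn}(q_n,K_n,V_n) := \sum_{\ell=1}^n \frac{e^{q_n^Tk_\ell}}{\sum_{m=1}^n e^{q_n^Tk_m}}\, v_\ell\in\mathbb{R}^d$. A vector $x\in\mathbb{R}^d$ is a $(1\pm\eta)$-approximation of $y\in\mathbb{R}^d$ if $|x_j-y_j|\le\eta\cdot y_j$ for all $j\in[d]$. *)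

(* Defs.v *)
(* MathComp-Analysis; the reals are an arbitrary [R : realType]. *)
From HB Require Import structures.
From mathcomp Require Import all_boot all_order all_algebra.
From mathcomp Require Import all_classical all_reals all_analysis.

Set Implicit Arguments.
Unset Strict Implicit.
Unset Printing Implicit Defensive.

Import Order.TTheory GRing.Theory Num.Theory.
Local Open Scope classical_set_scope.
Local Open Scope ring_scope.

Record triple (R : realType) (d : nat) := Triple {
  query : 'rV[R]_d;
  key : 'rV[R]_d;
  value : 'rV[R]_d }.

Definition dotv (R : realType) (d : nat) (x y : 'rV[R]_d) : R :=
  \sum_(j < d) x 0 j * y 0 j.

Definition Attn (R : realType) (n d : nat) (q : 'rV[R]_d) (K V : 'M[R]_(n, d)) :
    'rV[R]_d :=
  \sum_(l < n) (expR (dotv q (row l K)) / \sum_(m < n) expR (dotv q (row m K)))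
               *: row l V.

Definition key_matrix (R : realType) (n d : nat) (s : n.-tuple (triple R d)) :
    'M[R]_(n, d) := \matrix_(i < n) key (tnth s i).

Definition value_matrix (R : realType) (n d : nat) (s : n.-tuple (triple R d)) :
    'M[R]_(n, d) := \matrix_(i < n) value (tnth s i).

(* The default 0 is used only for the empty stream. *)
Definition last_query (R : realType) (n d : nat) (s : n.-tuple (triple R d)) :
    'rV[R]_d := last 0 [seq query x | x <- s].

Definition target (R : realType) (n d : nat) (s : n.-tuple (triple R d)) :
    'rV[R]_d := Attn (last_query s) (key_matrix s) (value_matrix s).

(* The bound is eta * y_j, without absolute value: no x approximates a y that
   has a negative coordinate. *)
Definition approximates (R : realType) (d : nat) (eta : R) (x y : 'rV[R]_d) :
    Prop := forall j : 'I_d, `|x 0 j - y 0 j| <= eta * y 0 j.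

(* A randomized one-pass algorithm with b bits of memory.  The memory is a
   b-bit string; w : W is the random seed.  Access to the seed and to the
   position of the current triple is not charged to the memory, so a position
   may use fresh or reused coins.  Neither the maps nor the memory are required
   to be computationally effective, and the algorithm may depend on the length
   of the stream and on d. *)
Record streaming_algorithm (R : realType) (disp : measure_display)
    (W : measurableType disp) (d b : nat) := StreamingAlgorithm {
  init : W -> b.-tuple bool;
  step : W -> nat -> b.-tuple bool -> triple R d -> b.-tuple bool;
  output : W -> b.-tuple bool -> 'rV[R]_d;
  measurable_init : forall m : b.-tuple bool,
    measurable [set w | init w = m];
  measurable_step : forall (i : nat) (m : b.-tuple bool) (x : triple R d)
      (m' : b.-tuple bool),
    measurable [set w | step w i m x = m'];
  measurable_output : forall (m : b.-tuple bool) (j : 'I_d),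
    measurable_fun [set: W] (fun w => output w m 0 j) }.

(* Reads s starting from memory m, its first triple being at position i. *)
Fixpoint run_from (R : realType) (disp : measure_display)
    (W : measurableType disp) (d b : nat) (A : streaming_algorithm R W d b)
    (w : W) (i : nat) (m : b.-tuple bool) (s : seq (triple R d)) :
    b.-tuple bool :=
  if s is x :: s' then run_from A w i.+1 (step A w i m x) s' else m.

Definition run (R : realType) (disp : measure_display)
    (W : measurableType disp) (d b : nat) (A : streaming_algorithm R W d b)
    (w : W) (s : seq (triple R d)) : 'rV[R]_d :=
  output A w (run_from A w 0 (init A w) s).

(* For every fixed stream of X, with probability at least 9/10 over the seed
   the output approximates the target. *)
Definition succeeds_on (R : realType) (disp : measure_display)
    (W : measurableType disp) (P : probability W R) (n d b : nat) (eta : R)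
    (A : streaming_algorithm R W d b) (X : set (n.-tuple (triple R d))) : Prop :=
  forall s, X s ->
    ((9 / 10)%:E <= P [set w | approximates eta (run A w s) (target s)])%E.

(* Streams with 0/1 values and queries and keys of polynomial magnitude.
   Success on every real stream is out of reach of any finite memory: a target
   may have a negative coordinate, and even nonnegative targets range over an
   unbounded interval and come arbitrarily close to 0.  On bounded streams each
   coordinate of the target is 0 or lies in a fixed compact subinterval of
   (0, 1], so success there is attainable with finite memory. *)
Definition bounded_streams (R : realType) (n d : nat) :
    set (n.-tuple (triple R d)) :=
  [set s | forall (i : 'I_n) (j : 'I_d),
    [/\ `|query (tnth s i) 0 j| <= n%:R ^+ 3,
        `|key (tnth s i) 0 j| <= n%:R ^+ 3 &
        value (tnth s i) 0 j = 0 \/ value (tnth s i) 0 j = 1]].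

(* Main.v *)
(* Reduction from one-way communication of a random N x d bit matrix V, with
   n = N + 1.  The first N triples carry the rows of V as values; their keys
   (l, l ^ 2) are in strictly convex position, so the last query can be
   n (2 i, -1), for which key i beats every other key by at least n.  The
   softmax weights then concentrate on i, so that any approximation of the attention
   reveals the whole row V i.  Fixing a seed that succeeds for at least 9/10 of
   the pairs (V, i), the memory after N triples determines at least half of the
   rows of V for at least half of the matrices V.  A fixed memory content can
   serve at most 2 ^ N * 2 ^ (d * N / 2) matrices: choose the correct rows, then
   the free ones.  Hence 2 ^ (d * N) <= 2 * 2 ^ b * 2 ^ N * 2 ^ (d * N / 2).

   Keys on the parabola need only d >= 2, where random nearly orthogonal keys
   would need d of order log n; here d >= C ln n only makes d >= 8, which
   absorbs the factor 2 ^ N. *)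
Require Import Defs.
From HB Require Import structures.
From mathcomp Require Import all_boot all_order all_algebra.
From mathcomp Require Import all_classical all_reals all_analysis.
From mathcomp Require Import measurable_realfun.
From mathcomp Require Import zify ring lra.

Set Implicit Arguments.
Unset Strict Implicit.
Unset Printing Implicit Defensive.

Import Order.TTheory GRing.Theory Num.Theory.
Local Open Scope classical_set_scope.
Local Open Scope ring_scope.

(** * Fixing the seed by averaging *)

(** The expected number of events that hold is at least [p * #|K|], hence so is its maximum over the
    seeds, which is attained because the count is a bounded natural number. *)
Lemma exists_many_events (R : realType) (disp : measure_display)
    (W : measurableType disp) (P : probability W R) (K : finType)
    (E : K -> set W) (p : R) :
  (forall k, measurable (E k)) -> (forall k, (p%:E <= P (E k))%E) ->
  exists w, p * #|K|%:R <= #|[pred k | `[< E k w >]]|%:R.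
Proof.
move=> mE pE; pose count w := #|[pred k | `[< E k w >]]|.
have [w count_max] : exists w, forall w', (count w' <= count w)%N.
  pose Q n := `[< exists w, count w = n >].
  have exQ : exists n, Q n by exists (count point); apply/asboolP; exists point.
  have ubQ n : Q n -> (n <= #|K|)%N by move=> /asboolP[w <-]; exact: max_card.
  case: (ex_maxnP exQ ubQ) => n /asboolP[w <-] max_n.
  by exists w => w'; apply: max_n; apply/asboolP; exists w'.
exists w; rewrite -lee_fin.
have countE w' : (\sum_(k : K) (\1_(E k) w')%:E)%E = (count w')%:R%:E :> \bar R.
  rewrite sumEFin /count -sum1_card; congr (_%:E).
  rewrite natr_sum [RHS]big_mkcond /=; apply: eq_bigr => k _.
  rewrite indicE inE /=.
  by case: asboolP => h; rewrite ?(mem_set h) ?(memNset h).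
have -> : (p * #|K|%:R)%:E = (\sum_(k : K) p%:E)%E.
  by rewrite sumEFin sumr_const mulr_natr.
apply: (@le_trans _ _ (\sum_(k : K) P (E k))%E); first by apply: lee_sum.
have -> : (\sum_(k : K) P (E k) = \int[P]_w' (\sum_(k : K) (\1_(E k) w')%:E))%E.
  rewrite ge0_integral_sum//.
  - by apply: eq_bigr => k _; rewrite integral_indic// setIT.
  - by move=> k; apply/measurable_EFinP; exact: measurable_indic.
have -> : ((count w)%:R%:E = \int[P]_w' cst ((count w)%:R)%:E w' :> \bar R)%E.
  by rewrite integral_cst//= probability_setT mule1.
apply: ge0_le_integral => //.
- by move=> w' _; apply: sume_ge0 => k _; rewrite lee_fin.
- apply: emeasurable_sum => k.
  by apply/measurable_EFinP; exact: measurable_indic.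
- by move=> w' _; rewrite countE lee_fin ler_nat.
Qed.

(** * Counting matrices against memory contents *)

Lemma card_agree_on (I T : finType) (g : I -> T) (S : {set I}) :
  #|[pred V : {ffun I -> T} | [forall i in S, V i == g i]]| =
  (#|T| ^ #|~: S|)%N.
Proof.
pose F i : pred T := if i \in S then pred1 (g i) else predT.
have -> : #|[pred V : {ffun I -> T} | [forall i in S, V i == g i]]| =
          #|family F|.
  apply: eq_card => V; rewrite inE; apply/forall_inP/familyP => h i.
  - by rewrite /F; case: ifP => // iS; rewrite inE; exact: h.
  - by move=> iS; have := h i; rewrite /F iS.
rewrite card_family foldrE big_map -prod_nat_const big_enum big_mkcond /=.
rewrite [RHS]big_mkcond /=; apply: eq_bigr => i _.
by rewrite finset.in_setC /F; case: (i \in S); rewrite ?card1.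
Qed.

(** Union bound over the set [S] of positions of agreement; each [S] leaves at most [N./2] entries
    free. *)
Lemma card_agree_half (N : nat) (T : finType) (g : 'I_N -> T) :
  (0 < #|T|)%N ->
  (#|[pred V : {ffun 'I_N -> T} | N <= 2 * #|[pred i | V i == g i]|]| <=
   2 ^ N * #|T| ^ N./2)%N.
Proof.
move=> T_gt0.
pose good (S : {set 'I_N}) :=
  [set V : {ffun 'I_N -> T} | [forall i in S, V i == g i]]%SET.
pose B := (\bigcup_(S : {set 'I_N} | (N <= 2 * #|S|)%N) good S)%SET.
apply: (@leq_trans #|B|).
  apply: subset_leq_card; apply/fintype.subsetP => V; rewrite inE => hV.
  apply/bigcupP; exists [set i | V i == g i]%SET.
    by rewrite cardsE.
  by rewrite inE; apply/forall_inP => i; rewrite inE.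
apply: (@leq_trans (\sum_(S : {set 'I_N} | (N <= 2 * #|S|)%N) #|good S|)).
  rewrite /B; elim/big_rec2: _ => [|S A n _ An]; first by rewrite cards0.
  by rewrite (leq_trans (leq_card_setU _ _))// leq_add2l.
apply: (@leq_trans (\sum_(S : {set 'I_N} | (N <= 2 * #|S|)%N) #|T| ^ N./2)).
  apply: leq_sum => S S_ge; rewrite cardsE card_agree_on leq_pexp2l//.
  have := cardsC S; rewrite card_ord geq_half_double -muln2.
  by move: #|S| #|~: S| S_ge => u v; lia.
rewrite sum_nat_const leq_mul2r; apply/orP; right.
by apply: leq_trans (max_card _) _;
  rewrite -finset.cardsT -powersetT card_powerset finset.cardsT card_ord.
Qed.

Lemma index_counting (N : nat) (T M : finType) (m : {ffun 'I_N -> T} -> M)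
    (g : M -> 'I_N -> T) : (0 < N)%N -> (0 < #|T|)%N ->
  (9 * (#|T| ^ N * N) <=
   10 * #|[pred x : {ffun 'I_N -> T} * 'I_N | x.1 x.2 == g (m x.1) x.2]|)%N ->
  (#|T| ^ N <= 2 * (#|M| * (2 ^ N * #|T| ^ N./2)))%N.
Proof.
move=> N_gt0 T_gt0 h.
pose a (V : {ffun 'I_N -> T}) := #|[pred i | V i == g (m V) i]|.
pose good := [pred V : {ffun 'I_N -> T} | N <= 2 * a V]%N.
have a_sum : #|[pred x : {ffun 'I_N -> T} * 'I_N | x.1 x.2 == g (m x.1) x.2]| =
             (\sum_V a V)%N.
  rewrite -sum1_card big_mkcond /=.
  rewrite -(pair_bigA _ (fun (V : {ffun 'I_N -> T}) i =>
                           if V i == g (m V) i then 1 else 0)%N) /=.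
  by apply: eq_bigr => V _; rewrite /a -sum1_card -big_mkcond.
have cardV : #|{: {ffun 'I_N -> T}}| = (#|T| ^ N)%N.
  by rewrite card_ffun card_ord.
(* [2 * a V] is at most [2 * N] for a good [V] and below [N] for any other. Combined with [h], this
   makes at least four fifths of all [V] good; half suffices. *)
have a_le : (2 * \sum_V a V <= N * #|good| + #|T| ^ N * N)%N.
  have -> : (N * #|good| = \sum_V (if good V then N else 0))%N.
    by rewrite -big_mkcond /= sum_nat_const mulnC.
  rewrite -cardV -sum_nat_const -big_split big_distrr /=.
  apply: leq_sum => V _; have : (a V <= N)%N.
    by rewrite -[X in (_ <= X)%N]card_ord; exact: max_card.
  by case: ifP; rewrite /good /=; lia.
have good_ge : (#|T| ^ N <= 2 * #|good|)%N by move: h; rewrite a_sum; nia.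
apply: leq_trans good_ge _; rewrite leq_mul2l /=.
(* Within one fibre of [m], all matrices are compared with the same guess [g x]. *)
have -> : #|good| = (\sum_(x : M) #|[pred V | good V && (m V == x)]|)%N.
  rewrite -sum1_card (partition_big m predT) //=.
  by apply: eq_bigr => x _; rewrite -sum1_card.
rewrite -sum_nat_const; apply: leq_sum => x _.
apply: leq_trans (card_agree_half (g x) T_gt0).
apply: subset_leq_card; apply/fintype.subsetP => V.
by rewrite !inE => /andP[hV /eqP <-].
Qed.

(** * Runs of the algorithm and measurability of success *)

Section streaming.
Context (R : realType) (disp : measure_display) (W : measurableType disp).
Context (d b : nat) (A : streaming_algorithm R W d b).

Lemma run_from_cat w i m s1 s2 :
  run_from A w i m (s1 ++ s2) =
  run_from A w (i + size s1) (run_from A w i m s1) s2.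
Proof.
by elim: s1 i m => [|x s1 IH] i m /=; rewrite ?addn0// IH addSnnS.
Qed.

(** The start [f] is arbitrary so that induction applies: after one step the memory is again a
    measurable function of the seed. *)
Lemma measurable_run_from (f : W -> b.-tuple bool) i s :
  (forall m, measurable [set w | f w = m]) ->
  forall m, measurable [set w | run_from A w i (f w) s = m].
Proof.
elim: s i f => [//|x s IH] i f mf m /=; apply: IH => m'.
have -> : [set w | step A w i (f w) x = m'] =
    \bigcup_(m0 : b.-tuple bool)
      ([set w | f w = m0] `&` [set w | step A w i m0 x = m']).
  by apply/seteqP; split=> [w <-|w [m0 _ [<- //]]]; exists (f w).
apply: fin_bigcup_measurable; first exact: finite_finset.
by move=> m0 _; apply: measurableI; [exact: mf|exact: measurable_step].
Qed.

Lemma measurable_approximates (eta : R) s (y : 'rV[R]_d) :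
  measurable [set w | approximates eta (run A w s) y].
Proof.
(* The output is known to be measurable only at a fixed memory, so the event is split by the final
   memory content. *)
have -> : [set w | approximates eta (run A w s) y] =
    \bigcup_(m : b.-tuple bool)
      ([set w | run_from A w 0 (init A w) s = m] `&`
       \bigcap_(j : 'I_d)
         [set w | `|output A w m 0 j - y 0 j| <= eta * y 0 j]).
  apply/seteqP; split=> [w h|w [m _ [<- h]] j]; last exact: h.
  by exists (run_from A w 0 (init A w) s) => //; split=> // j _; exact: h.
apply: fin_bigcup_measurable => [|m _]; first exact: finite_finset.
apply: measurableI.
  by apply: measurable_run_from; exact: measurable_init.
apply: fin_bigcap_measurable => [|j _]; first exact: finite_finset.
rewrite -[X in measurable X]setTI; apply: measurable_fun_le => //.
apply: (@measurableT_comp _ _ _ _ _ _ (@Num.norm R R)) => //.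
by apply: measurable_funB => //; exact: measurable_output.
Qed.

End streaming.

(** * Softmax weights and decoding of one bit *)

Section softmax.
Context (R : realType) (n d : nat) (q : 'rV[R]_d) (K : 'M[R]_(n, d)).

Definition softmax (l : 'I_n) : R :=
  expR (dotv q (row l K)) / \sum_(m < n) expR (dotv q (row m K)).

Lemma AttnE (V : 'M[R]_(n, d)) (j : 'I_d) :
  Attn q K V 0 j = \sum_(l < n) softmax l * V l j.
Proof. by rewrite /Attn summxE; apply: eq_bigr => l _; rewrite !mxE. Qed.

Lemma softmax_gt0 l : 0 < softmax l.
Proof.
rewrite divr_gt0 ?expR_gt0// (bigD1 l)//= ltr_pwDl ?expR_gt0//.
by apply: sumr_ge0 => m _; exact: expR_ge0.
Qed.

Lemma softmax_gap (i l : 'I_n) (t : R) :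
  dotv q (row l K) <= dotv q (row i K) - t ->
  softmax l <= expR (- t) * softmax i.
Proof.
move=> h; rewrite /softmax mulrA -expRD; apply: ler_wpM2r; last first.
  by rewrite ler_expR; lra.
by rewrite invr_ge0; apply: sumr_ge0 => m _; exact: expR_ge0.
Qed.

(* The weight of i exceeds the total weight of the other positions by a factor
   of more than (1 + eta) / (1 - eta). *)
Lemma Attn_decode (V : 'M[R]_(n, d)) (i : 'I_n) (j : 'I_d) (t eta : R)
    (v : 'I_n -> bool) (x : 'rV[R]_d) :
  0 < eta -> eta < 1 -> (1 + eta) * (n%:R * expR (- t)) < 1 - eta ->
  (forall l, l != i -> dotv q (row l K) <= dotv q (row i K) - t) ->
  (forall l, V l j = (v l)%:R) ->
  approximates eta x (Attn q K V) ->
  ((1 - eta) * softmax i <= x 0 j) = v i.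
Proof.
move=> eta_gt0 eta_lt1 small gap Vv /(_ j); rewrite ler_norml => /andP[lo hi].
have w_gt0 := softmax_gt0 i.
(* A bit 1 puts the target at or above [softmax i]. A bit 0 leaves only the other positions, whose
   total stays below the threshold even after the factor [1 + eta]. *)
case vi: (v i).
  have : softmax i <= Attn q K V 0 j.
    rewrite AttnE (bigD1 i)//= Vv vi mulr1 lerDl.
    by apply: sumr_ge0 => l _; rewrite Vv mulr_ge0// ltW// softmax_gt0.
  by nra.
apply/negbTE; rewrite -ltNge.
have : Attn q K V 0 j <= n%:R * expR (- t) * softmax i.
  have -> : n%:R * expR (- t) * softmax i =
            \sum_(l < n) expR (- t) * softmax i.
    by rewrite sumr_const card_ord -mulrA mulr_natl.
  rewrite AttnE; apply: ler_sum => l _; rewrite Vv.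
  have [->|li] := eqVneq l i.
    by rewrite vi mulr0 mulr_ge0 ?expR_ge0// ltW.
  apply: le_trans (softmax_gap (gap _ li)).
  by case: (v l); rewrite ?mulr1 ?mulr0// ltW// softmax_gt0.
move: (n%:R * expR (- t)) small => e small he.
have : (1 + eta) * (e * softmax i) < (1 - eta) * softmax i.
  by rewrite mulrA ltr_pM2r.
by nra.
Qed.

End softmax.

(** * The hard streams *)

(* The points (x, x ^ 2), and the functional T (2 x, -1), whose maximum on the
   parabola is attained at x alone. *)
Definition parabola_key (R : realType) (d : nat) (x : R) : 'rV[R]_d :=
  \row_(j < d) [:: x; x ^+ 2]`_j.

Definition parabola_query (R : realType) (d : nat) (T x : R) : 'rV[R]_d :=
  \row_(j < d) [:: T * (2 * x); - T]`_j.

(** Completing the square; from the third coordinate on, both vectors take the default 0 of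
    [nth]. *)
Lemma dotv_parabola (R : realType) (d : nat) (T x y : R) : (2 <= d)%N ->
  dotv (parabola_query d T x) (parabola_key d y) =
  T * x ^+ 2 - T * (x - y) ^+ 2.
Proof.
case: d => [|[|d]]// _; rewrite /dotv !big_ord_recl big1 => [|j _].
  by rewrite !mxE /=; ring.
by rewrite !mxE /= /bump /= !nth_nil mul0r.
Qed.

(** Only the last triple depends on [i], and it does not depend on [V]: this is the cut of the
    one-way protocol. The last triple also enters the attention sum, so its value is 0 and its key
    continues the parabola. *)
Definition index_stream (R : realType) (N d : nat)
    (V : {ffun 'I_N -> d.-tuple bool}) (i : 'I_N) :
    N.+1.-tuple (triple R d) :=
  [tuple if unlift ord_max l is Some l'
         then Triple 0 (parabola_key d l%:R) (\row_j (tnth (V l') j)%:R)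
         else Triple (parabola_query d N.+1%:R i%:R) (parabola_key d l%:R) 0
   | l < N.+1].

Lemma index_streamE (R : realType) (N d : nat)
    (V : {ffun 'I_N -> d.-tuple bool}) (i : 'I_N) :
  index_stream R V i =
  rcons [seq Triple 0 (parabola_key d l%:R) (\row_j (tnth (V l) j)%:R)
        | l : 'I_N <- enum 'I_N]
    (Triple (parabola_query d N.+1%:R i%:R) (parabola_key d N%:R) 0)
  :> seq (triple R d).
Proof.
rewrite /= enum_ordSr map_rcons unlift_none; congr rcons.
rewrite -map_comp; apply: eq_map => l /=.
have -> : widen_ord (leqnSn N) l = lift ord_max l.
  by apply/val_inj; rewrite /= /bump leqNgt ltn_ord.
by rewrite liftK.
Qed.

Lemma index_stream_bounded (R : realType) (N d : nat)
    (V : {ffun 'I_N -> d.-tuple bool}) (i : 'I_N) : (0 < N)%N ->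
  @bounded_streams R N.+1 d (index_stream R V i).
Proof.
move=> N_gt0 l j; rewrite tnth_mktuple.
have n_ge2 : (2 : R) <= N.+1%:R by rewrite ler_nat.
have i_le : (i%:R : R) <= N.+1%:R by rewrite ler_nat ltnW// ltnS ltnW.
have l_le : (l%:R : R) <= N.+1%:R by rewrite ler_nat ltnW.
have i_ge0 : 0 <= i%:R :> R by [].
have l_ge0 : 0 <= l%:R :> R by [].
have key_le : `|parabola_key d l%:R 0 j| <= N.+1%:R ^+ 3 :> R.
  rewrite mxE; case: (j : nat) => [|[|k]] /=.
  - by rewrite ger0_norm//; nra.
  - by rewrite ger0_norm ?sqr_ge0//; nra.
  - by rewrite nth_nil normr0 exprn_ge0.
case: unliftP => [l' _|_] /=; split=> //.
- by rewrite mxE normr0 exprn_ge0.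
- by rewrite mxE; case: (tnth _ _); [right|left].
- rewrite mxE; case: (j : nat) => [|[|k]] /=.
  + by rewrite ger0_norm ?mulr_ge0//; nra.
  + by rewrite normrN ger0_norm//; nra.
  + by rewrite nth_nil normr0 exprn_ge0.
- by left; rewrite mxE.
Qed.

(** The decoded row is a function of [x] and [i] alone: the weights do not involve [V], so the
    receiver knows the threshold. *)
Lemma target_index_stream_decode (R : realType) (N d : nat) (eta : R)
    (V : {ffun 'I_N -> d.-tuple bool}) (i : 'I_N) (x : 'rV[R]_d) :
  (2 <= d)%N -> 0 < eta -> eta < 1 ->
  (1 + eta) * (N.+1%:R * expR (- N.+1%:R)) < 1 - eta ->
  approximates eta x (target (index_stream R V i)) ->
  V i = [tuple (1 - eta) * softmax (parabola_query d N.+1%:R i%:R)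
                   (\matrix_(l < N.+1) parabola_key d l%:R) (lift ord_max i)
                 <= x 0 j | j < d].
Proof.
move=> d_ge2 eta_gt0 eta_lt1 small; rewrite /target.
have -> : last_query (index_stream R V i) = parabola_query d N.+1%:R i%:R.
  by rewrite /last_query index_streamE map_rcons last_rcons.
have -> : key_matrix (index_stream R V i) =
          \matrix_(l < N.+1) parabola_key d l%:R.
  apply/row_matrixP => l; rewrite !rowK tnth_mktuple.
  by case: unlift.
move=> ap; apply: eq_from_tnth => j; rewrite tnth_mktuple.
pose v (l : 'I_N.+1) := if unlift ord_max l is Some l'
                       then tnth (V l') j else false.
have vE : v (lift ord_max i) = tnth (V i) j by rewrite /v liftK.
rewrite -vE; apply/esym; apply: Attn_decode ap => //.
- exact: small.
(* The gap is [N.+1 * (i - l) ^ 2], and distinct integers differ by at least 1. *)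
- move=> l li; rewrite !rowK !dotv_parabola// lift_max subrr expr0n mulr0 subr0.
  rewrite lerD2l lerN2 ler_peMr//.
  have [il|il] := ltnP i l.
    have : (i%:R + 1 <= l%:R :> R) by rewrite natr1 ler_nat.
    nra.
  have {}il : (l < i)%N.
    rewrite ltn_neqAle il andbT; apply: contra li => /eqP li.
    by apply/eqP/ord_inj; rewrite lift_max.
  have : (l%:R + 1 <= i%:R :> R) by rewrite natr1 ler_nat.
  nra.
- move=> l; rewrite mxE tnth_mktuple /v; case: unlift => [l'|]; by rewrite mxE.
Qed.

(** * From success to the memory bound *)

Lemma success_memory_bound (R : realType) (N d b : nat)
    (disp : measure_display) (W : measurableType disp) (P : probability W R)
    (eta : R) (A : streaming_algorithm R W d b) :
  (0 < N)%N -> (2 <= d)%N -> 0 < eta -> eta < 1 ->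
  (1 + eta) * (N.+1%:R * expR (- N.+1%:R)) < 1 - eta ->
  succeeds_on P eta A (@bounded_streams R N.+1 d) ->
  (d * N <= 1 + b + N + d * N./2)%N.
Proof.
move=> N_gt0 d_ge2 eta_gt0 eta_lt1 small succ.
pose E (x : {ffun 'I_N -> d.-tuple bool} * 'I_N) :=
  [set w | approximates eta (run A w (index_stream R x.1 x.2))
                        (target (index_stream R x.1 x.2))].
have [w] : exists w, 9 / 10 * #|{: {ffun 'I_N -> d.-tuple bool} * 'I_N}|%:R <=
                     #|[pred x | `[< E x w >]]|%:R :> R.
  apply: (@exists_many_events _ _ _ P) => x.
  - exact: measurable_approximates.
  - exact/succ/index_stream_bounded.
rewrite card_prod card_ffun card_tuple card_bool card_ord => many.
pose prefix (V : {ffun 'I_N -> d.-tuple bool}) : seq (triple R d) :=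
  [seq Triple 0 (parabola_key d l%:R) (\row_j (tnth (V l) j)%:R)
  | l : 'I_N <- enum 'I_N].
pose mem V := run_from A w 0 (init A w) (prefix V).
(* The receiver feeds the last triple, at position [N], to the memory [m] and thresholds the
   output. *)
pose decode (m : b.-tuple bool) (i : 'I_N) :=
  [tuple (1 - eta) * softmax (parabola_query d N.+1%:R i%:R)
             (\matrix_(l < N.+1) parabola_key d l%:R) (lift ord_max i)
         <= output A w (step A w N m (Triple (parabola_query d N.+1%:R i%:R)
                                             (parabola_key d N%:R) 0)) 0 j
  | j < d].
have decodeE V i : E (V, i) w -> V i = decode (mem V) i.
  move=> /(target_index_stream_decode d_ge2 eta_gt0 eta_lt1 small) ->.
  by rewrite /run index_streamE -cats1 run_from_cat size_map size_enum_ord.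
have := @index_counting N (d.-tuple bool) (b.-tuple bool) mem decode N_gt0.
rewrite !card_tuple card_bool expn_gt0 => /(_ isT) counting.
have {}counting : (2 ^ (d * N) <= 2 ^ (1 + b + N + d * N./2))%N.
  rewrite !expnD -!mulnA !expnM expn1; apply: counting.
  have sub : (#|[pred x | `[< E x w >]]| <=
      #|[pred x : {ffun 'I_N -> d.-tuple bool} * 'I_N |
          x.1 x.2 == decode (mem x.1) x.2]|)%N.
    apply: subset_leq_card; apply/fintype.subsetP => -[V i].
    by rewrite !inE /= => /decodeE ->.
  have : (9 * ((2 ^ d) ^ N * N) <= 10 * #|[pred x | `[< E x w >]]|)%N.
    rewrite -(ler_nat R) !natrM; move: many; rewrite natrM.
    lra.
  by move=> /leq_trans; apply; rewrite leq_mul2l.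
by move: counting; rewrite leq_exp2l.
Qed.

(** Squaring [1 + x / 2 <= expR (x / 2)] gives [x ^ 2 / 4 <= expR x]. *)
Lemma mulr_expRN_le (R : realType) (x : R) : 0 < x ->
  x * expR (- x) <= 4 / x.
Proof.
move=> x_gt0; rewrite expRN ler_pdivrMr ?expR_gt0// mulrAC ler_pdivlMr//.
have : x ^+ 2 / 4 <= expR x.
  have -> : x = x / 2 + x / 2 by lra.
  rewrite expRD; have := expR_ge1Dx (x / 2); nra.
lra.
Qed.

Theorem theorem8 (R : realType) :
  exists2 c : R, 0 < c &
  forall eta C : R, 0 < eta -> eta < 1 -> 0 < C ->
  exists n0 : nat, forall n d : nat, (n0 <= n)%N -> C * ln n%:R <= d%:R ->
  forall (b : nat) (disp : measure_display) (W : measurableType disp)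
         (P : probability W R) (A : streaming_algorithm R W d b),
    (succeeds_on P eta A [set: n.-tuple (triple R d)] ->
       c * n%:R * d%:R <= b%:R) /\
    (succeeds_on P eta A (@bounded_streams R n d) ->
       c * n%:R * d%:R <= b%:R).
Proof.
exists (1 / 8) => [|eta C eta_gt0 eta_lt1 C_gt0]; first by lra.
(* The summands ensure in turn [2 < n], [8 <= C * ln n] and [4 / n < (1 - eta) / 2]. *)
pose x : R := 2 + expR (8 / C) + 8 / (1 - eta).
have e_gt0 : 0 < expR (8 / C) by exact: expR_gt0.
have r_gt0 : 0 < 8 / (1 - eta) by rewrite divr_gt0//; lra.
exists (Num.bound x) => n d n_ge d_ge b disp W P A.
have n_gtx : x < n%:R.
  by apply: lt_le_trans (archi_boundP _) _; rewrite ?ler_nat// /x; lra.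
suff bounded : succeeds_on P eta A (@bounded_streams R n d) ->
    1 / 8 * n%:R * d%:R <= b%:R :> R.
  by split=> // all_succ; apply: bounded => s _; exact: all_succ.
have n_gt2 : (2 < n)%N by rewrite -(ltr_nat R); rewrite /x in n_gtx; lra.
have d_ge8 : (8 <= d)%N.
  rewrite -(ler_nat R); apply: le_trans d_ge.
  rewrite mulrC -ler_pdivrMr// -(expRK (8 / C)) ler_ln ?posrE//.
    by rewrite /x in n_gtx; lra.
  by rewrite ltr0n; lia.
have small : (1 + eta) * (n%:R * expR (- n%:R)) < 1 - eta.
  have n_gt0 : 0 < n%:R :> R by rewrite ltr0n; lia.
  have le4 := mulr_expRN_le n_gt0.
  have : 4 / n%:R < (1 - eta) / 2.
    have : 8 < n%:R * (1 - eta).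
      have eta1_gt0 : 0 < 1 - eta by lra.
      by rewrite -ltr_pdivrMr//; rewrite /x in n_gtx; lra.
    by rewrite ltr_pdivrMr//; lra.
  nra.
case: n n_gt2 small {n_ge d_ge n_gtx} => // N N_ge2 small.
move=> /(success_memory_bound _ _ eta_gt0 eta_lt1 small) => bound.
have {}bound : (d * N <= 1 + b + N + d * N./2)%N by apply: bound; lia.
(* The bound gives [b >= d * N / 2 - N - 1]. As [d >= 8], this is at least [3 * d * N / 8 - 1],
   which exceeds [d * N.+1 / 8] since [N >= 2]. *)
have : (N.+1 * d <= 8 * b)%N.
  have half_le : (2 * N./2 <= N)%N by rewrite mul2n -geq_half_double.
  by nia.
by rewrite -(ler_nat R) !natrM; lra.
Qed.
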